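(* Let $g,\gamma$ be nonnegative integers with $2g\ge 3\gamma$. Then $N_\gamma(g)\le N_\gamma(3\gamma)$, and equality $N_\gamma(g)=N_\gamma(3\gamma)$ holds if and only if $g\ge 3\gamma$.
   Context: Let $\mathbb{N}_0$ be the set of nonnegative integers. A numerical semigroup $S$ is a submonoid of $(\mathbb{N}_0,+)$ whose set of gaps $G(S)=\mathbb{N}_0\setminus S$ is finite; its genus is $g(S)=\#G(S)$. For nonnegative integers $g,\gamma$, $N_\gamma(g)$ denotes the number of numerical semigroups of genus $g$ having exactly $\gamma$ even gaps. *)

(* Defs.v *)
From mathcomp Require Import all_boot finmap.
From mathcomp Require Import boolp classical_sets functions cardinality.

Set Implicit Arguments.
Unset Strict Implicit.
Unset Printing Implicit Defensive.

Local Open Scope classical_set_scope.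

Definition gaps (S : set nat) : set nat := ~` S.

Definition numerical_semigroup (S : set nat) : Prop :=
  [/\ S 0, (forall x y, S x -> S y -> S (x + y)) & finite_set (gaps S)].

(* [fset_set A] is empty when [A] is infinite. Below it is only relevant for the
   gaps of a numerical semigroup, finite by definition, and for the set of
   semigroups counted, finite by [finite_semigroups_genus_even]. *)
Definition genus (S : set nat) : nat := #|` fset_set (gaps S)|.

Definition even_gaps (S : set nat) : set nat := [set x | gaps S x /\ ~~ odd x].

Definition semigroups_genus_even (gamma g : nat) : set (set nat) :=
  [set S | [/\ numerical_semigroup S, genus S = g
             & #|` fset_set (even_gaps S)| = gamma]].

Definition num_semigroups (gamma g : nat) : nat :=
  #|` fset_set (semigroups_genus_even gamma g)|.

Lemma gaps_lt (S : set nat) (x : nat) :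
  numerical_semigroup S -> gaps S x -> x < (genus S).*2.
Proof.
move=> [_ SD Sfin] Sx; rewrite /genus.
set F := fset_set _.
have FE y : (y \in F) = (y \in gaps S) by rewrite in_fset_set.
pose L := enum_fset F ++ [seq x - y | y <- enum_fset F].
have sub : {subset iota 0 x.+1 <= L}.
  move=> i; rewrite mem_iota add0n ltnS /= => lix; rewrite mem_cat.
  have [Si|nSi] := pselect (S i); last first.
    by apply/orP; left; rewrite FE; apply/mem_set.
  apply/orP; right; apply/mapP; exists (x - i); last by rewrite subKn.
  rewrite FE; apply/mem_set => Sxi; apply: Sx.
  by rewrite -(subnKC lix); exact: SD.
have := uniq_leq_size (iota_uniq _ _) sub.
by rewrite size_iota size_cat size_map addnn.
Qed.

Lemma finite_semigroups_genus_even (gamma g : nat) :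
  finite_set (semigroups_genus_even gamma g).
Proof.
pose f (A : {set 'I_(g.*2)}) : set nat := ~` [set val i | i in [set` A]].
apply: (@sub_finite_set _ _ (f @` [set: {set 'I_(g.*2)}])); last first.
  by apply: finite_image; exact: finite_finset.
move=> S [nsS gS _].
exists [set i : 'I_(g.*2) | `[< gaps S (val i) >]]%SET => //.
rewrite /f; apply/seteqP; split => [x /= nx|x Sx /= [i]].
  apply: contrapT => nSx; apply: nx.
  have ltx : x < g.*2 by rewrite -gS; exact: gaps_lt.
  by exists (Ordinal ltx) => //=; rewrite inE; apply/asboolP.
by rewrite inE => /asboolP ni ix; apply: ni; rewrite ix.
Qed.

(* Main.v *)
Require Import Defs.
From mathcomp Require Import all_boot finmap zify.
From mathcomp Require Import boolp classical_sets functions cardinality.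

(** Halving the even and the odd elements separately encodes a set of naturals
    as a pair (T, M), the set being 2T together with 2M + 1. It is a numerical
    semigroup with gamma even gaps exactly when T is a numerical semigroup of
    genus gamma, M is cofinite, M + T is contained in M, and M + M + 1 is
    contained in T; its genus is then gamma plus the number of naturals missing
    from M. Every condition but the last one is invariant under translating M,
    and translating M by d raises the genus by d.

    The last condition is automatic in genus at least 3 gamma: if m is in M then
    so is m + T, hence at most m + gamma naturals are missing from M, and as at
    least 2 gamma are missing, m >= gamma. So elements of M + M + 1 exceed
    2 gamma, while all gaps of T are below 2 gamma. Consequently translation
    maps the semigroups of genus g injectively to those of genus g + d whenever
    g + d >= 3 gamma ([shift_odds_semigroup]), and onto them when moreover
    g >= 3 gamma ([shift_odds_image]); this gives the inequality and the
    equality for large g.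

    For g < 3 gamma the map to genus 3 gamma is not onto
    ([shift_odds_not_onto]): let T be the semigroup generated by 2 and
    2 gamma + 1, and M = gamma + T. Translating M back by d = 3 gamma - g > 0
    would put gamma - d in M, forcing the odd number 2 (gamma - d) + 1 < 2 gamma
    to be in T, where it is not. *)

Set Implicit Arguments.
Unset Strict Implicit.
Unset Printing Implicit Defensive.

Local Open Scope classical_set_scope.

(** * Cardinals of finite sets *)

Local Notation card A := #|` fset_set A|.

Lemma card_setU (T : choiceType) (A B : set T) :
  finite_set A -> finite_set B -> A `&` B = set0 ->
  card (A `|` B) = card A + card B.
Proof.
move=> fA fB AB; rewrite fset_setU // -[LHS]addn0 -cardfsUI; congr (_ + _).
by rewrite -fset_setI // AB fset_set0 cardfs0.
Qed.

Lemma card_image (T U : choiceType) (f : T -> U) (A : set T) :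
  injective f -> finite_set A -> card (f @` A) = card A.
Proof. by move=> fI fA; rewrite fset_set_image // card_imfset. Qed.

Lemma finite_imageE (T U : choiceType) (f : T -> U) (A : set T) :
  injective f -> finite_set (f @` A) = finite_set A.
Proof.
by move=> fI; apply: eq_finite_set; apply: inj_card_eq => x y _ _; exact: fI.
Qed.

Lemma card_subset (T : choiceType) (A B : set T) :
  finite_set B -> A `<=` B -> card A <= card B.
Proof.
move=> fB AB; have fA := sub_finite_set AB fB.
by apply: fsubset_leq_card; rewrite -fset_set_sub.
Qed.

Lemma card_subset_eq (T : choiceType) (A B : set T) :
  finite_set B -> A `<=` B -> card A = card B -> A = B.
Proof.
move=> fB AB eAB; have fA := sub_finite_set AB fB.
apply: fset_set_inj => //; apply/eqP.
by rewrite eqEfcard eAB leqnn andbT -fset_set_sub.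
Qed.

Lemma card_II n : card `I_n = n.
Proof. by apply: card_fset_set; exact: card_eqxx. Qed.

(** * Splitting a set of naturals by parity *)

Lemma doubleS_inj : injective (fun m => m.*2.+1).
Proof. by move=> m m' [] /double_inj. Qed.

Definition glue (T M : set nat) : set nat :=
  [set x | if odd x then M x./2 else T x./2].

Definition evens (S : set nat) : set nat := [set t | S t.*2].

Definition odds (S : set nat) : set nat := [set m | S m.*2.+1].

Lemma glueK S : glue (evens S) (odds S) = S.
Proof.
apply/funext => x; rewrite /glue /evens /odds /=.
by have := odd_double_half x; case: (odd x) => /= e; rewrite -[in RHS]e.
Qed.

Lemma evens_glue T M : evens (glue T M) = T.
Proof. by apply/funext => t; rewrite /evens /glue /= odd_double doubleK. Qed.

Lemma odds_glue T M : odds (glue T M) = M.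
Proof.
by apply/funext => t; rewrite /odds /glue /= odd_double /= uphalf_double.
Qed.

Lemma even_gaps_glue T M : even_gaps (glue T M) = double @` (~` T).
Proof.
apply/seteqP; split=> x; rewrite /even_gaps /gaps /glue /=.
  by move=> [+ /negbTE ox]; rewrite ox => nT; exists x./2 => //; lia.
by move=> [t nt <-]; rewrite odd_double doubleK.
Qed.

Lemma gaps_glue T M :
  gaps (glue T M) = double @` (~` T) `|` (fun m => m.*2.+1) @` (~` M).
Proof.
apply/seteqP; split=> x; rewrite /gaps /glue /=.
  by case: ifP => ox nx; [right|left]; exists x./2 => //; lia.
case=> [[t nt <-]|[m nm <-]] /=; first by rewrite odd_double doubleK.
by rewrite odd_double /= uphalf_double.
Qed.

Definition relative_ideal (T M : set nat) : Prop :=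
  forall m t, M m -> T t -> M (m + t).

(** An even number and an odd one add up to an odd one, which makes M a
    T-ideal; the odd numbers 2m + 1 and 2m' + 1 add up to twice m + m' + 1,
    which is where the successor comes from. *)
Lemma numerical_semigroup_glueP T M :
  numerical_semigroup (glue T M) <->
  [/\ numerical_semigroup T, relative_ideal T M, finite_set (~` M)
    & forall m m', M m -> M m' -> T (m + m').+1].
Proof.
have inT t : glue T M t.*2 = T t by rewrite -[in RHS](evens_glue T M).
have inM m : glue T M m.*2.+1 = M m by rewrite -[in RHS](odds_glue T M).
split=> [[S0 SD fS]|[[T0 TD fT] MT fM MM]]; last first.
  split; first by rewrite -[0]/(0.*2) inT.
  - move=> x y.
    rewrite -(odd_double_half x) -(odd_double_half y).
    case: (odd x); case: (odd y); rewrite ?add1n ?add0n.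
    + rewrite !inM => Mx My.
      have -> : x./2.*2.+1 + y./2.*2.+1 = (x./2 + y./2).+1.*2 by lia.
      by rewrite inT; exact: MM.
    + rewrite inM inT => Mx Ty; rewrite addSn -doubleD inM; exact: MT.
    + rewrite inM inT => Tx My; rewrite addnS -doubleD inM addnC; exact: MT.
    + by rewrite !inT -doubleD inT; exact: TD.
  - by rewrite gaps_glue finite_setU; split; exact: finite_image.
move: fS; rewrite gaps_glue finite_setU => -[fT fM].
split=> [|m t Mm Tt||m m' Mm Mm'].
- split; first by rewrite -inT.
    by move=> t t' Tt Tt'; rewrite -inT doubleD; apply: SD; rewrite inT.
  by rewrite -(finite_imageE _ double_inj).
- by rewrite -inM doubleD -addSn; apply: SD; rewrite ?inM ?inT.
- by rewrite -(finite_imageE _ doubleS_inj).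
- rewrite -inT doubleS doubleD -addnS -addSn.
  by apply: SD; rewrite inM.
Qed.

Lemma genus_glue T M : finite_set (~` T) -> finite_set (~` M) ->
  genus (glue T M) = genus T + card (~` M).
Proof.
move=> fT fM; rewrite /genus gaps_glue card_setU; first last.
- by apply/seteqP; split=> // x [[t _ <-] [m _]]; lia.
- exact: finite_image.
- exact: finite_image.
by rewrite !card_image //; [exact: doubleS_inj|exact: double_inj].
Qed.

Lemma semigroups_glueP gamma g T M :
  semigroups_genus_even gamma g (glue T M) <->
  [/\ numerical_semigroup T, genus T = gamma, relative_ideal T M,
      finite_set (~` M) & gamma + card (~` M) = g /\
      forall m m', M m -> M m' -> T (m + m').+1].
Proof.
have even_card : finite_set (~` T) ->
    card (even_gaps (glue T M)) = genus T.
  by move=> fT; rewrite even_gaps_glue card_image //; exact: double_inj.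
split.
  move=> [/numerical_semigroup_glueP[nT MT fM MM]]; have [_ _ fT] := nT.
  by rewrite genus_glue // even_card // => gM gT; split=> //; rewrite -gM gT.
move=> [nT gT MT fM [gM MM]]; have [_ _ fT] := nT.
split; rewrite ?genus_glue ?even_card ?gT //.
exact/numerical_semigroup_glueP.
Qed.

(** * The sum condition in large genus *)

(** Since m + T lies in M, a natural missing from M is below m or is the
    translate by m of a gap of T. *)
Lemma relative_ideal_min T M m : finite_set (~` T) -> relative_ideal T M ->
  M m -> card (~` M) <= m + genus T.
Proof.
move=> fT MT Mm.
have sub : ~` M `<=` `I_m `|` addn m @` (~` T).
  move=> x nMx; have [xm|mx] := ltnP x m; [by left|right].
  exists (x - m); last by rewrite subnKC.
  by move=> Tx; apply: nMx; rewrite -(subnKC mx); exact: MT.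
have finI : finite_set (addn m @` (~` T)) by exact: finite_image.
apply: leq_trans (card_subset _ sub) _.
  by rewrite finite_setU; split => //; exact: finite_II.
rewrite card_setU //; first by rewrite card_II card_image //; exact: addnI.
by apply/seteqP; split=> // x [/= xm [t _]]; lia.
Qed.

(** Elements of M are at least [genus T] by [relative_ideal_min], so their sum
    plus one passes every gap of T. This is what makes 3 gamma the threshold:
    the genus of [glue T M] is [genus T] plus the cardinal bounded here. *)
Lemma relative_ideal_sum T M m m' : numerical_semigroup T ->
  relative_ideal T M -> 2 * genus T <= card (~` M) ->
  M m -> M m' -> T (m + m').+1.
Proof.
move=> nT MT cM Mm Mm'; have [_ _ fT] := nT; apply: contrapT => nTm.
have := gaps_lt nT nTm.
have := relative_ideal_min fT MT Mm; have := relative_ideal_min fT MT Mm'.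
lia.
Qed.

(** * Translating the odd elements *)

Definition shift_odds (d : nat) (S : set nat) : set nat :=
  glue (evens S) (addn d @` odds S).

Lemma shift_odds_inj d : injective (shift_odds d).
Proof.
move=> S S' eS; rewrite -(glueK S) -(glueK S').
have := congr1 evens eS; rewrite /shift_odds !evens_glue => ->.
congr glue; apply/funext => m; have := congr1 odds eS.
rewrite /shift_odds !odds_glue => eO.
by rewrite -(@image_inj _ _ (addn d) (odds S)) ?eO ?image_inj //; exact: addnI.
Qed.

Lemma setC_translate d (M : set nat) :
  ~` (addn d @` M) = `I_d `|` addn d @` (~` M).
Proof.
apply/seteqP; split=> x /=.
  move=> nx; have [xd|dx] := ltnP x d; [by left|right].
  exists (x - d); last by rewrite subnKC.
  by move=> Mx; apply: nx; exists (x - d) => //; rewrite subnKC.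
case=> [xd [m _]|[m nm <-] [m' Mm' /addnI e]]; first lia.
by apply: nm; rewrite -e.
Qed.

Lemma finite_translate d (M : set nat) :
  finite_set (~` (addn d @` M)) <-> finite_set (~` M).
Proof.
rewrite setC_translate finite_setU (finite_imageE _ (@addnI d)).
by split=> [[]//|fM]; split=> //; exact: finite_II.
Qed.

Lemma card_translate d (M : set nat) : finite_set (~` M) ->
  card (~` (addn d @` M)) = d + card (~` M).
Proof.
move=> fM; rewrite setC_translate card_setU.
- by rewrite card_II card_image //; exact: addnI.
- exact: finite_II.
- exact: finite_image.
- by apply/seteqP; split=> // x [/= xd [m _]]; lia.
Qed.

Lemma relative_ideal_translate d T M :
  relative_ideal T (addn d @` M) <-> relative_ideal T M.
Proof.
split=> MT m t; last first.
  by case=> m' Mm' <- Tt; exists (m' + t); [exact: MT|rewrite addnA].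
move=> Mm Tt; rewrite -(image_inj (@addnI d)) addnA.
by apply: MT => //; exists m.
Qed.

(** Only the sum condition can fail to survive a translation, and it is
    restored by the size of the target genus. The source genus is
    unconstrained, which is what gives the inequality below 3 gamma. *)
Lemma shift_odds_semigroup gamma g d S : 3 * gamma <= g + d ->
  semigroups_genus_even gamma g S ->
  semigroups_genus_even gamma (g + d) (shift_odds d S).
Proof.
move=> gd; rewrite -[S in semigroups_genus_even _ _ S]glueK.
move=> /semigroups_glueP[nT gT MT fM [gM _]]; apply/semigroups_glueP.
split=> //; [exact/relative_ideal_translate|exact/finite_translate|].
have cM := card_translate d fM; split; first by rewrite cM; lia.
move=> m m'; apply: relative_ideal_sum => //.
  exact/relative_ideal_translate.
by rewrite gT cM; lia.
Qed.

(** Surjectivity: in genus g + d every element of M is at least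
    g + d - 2 gamma, hence at least d, so M can be translated back by d; the
    sum condition then holds in genus g because g >= 3 gamma. *)
Lemma shift_odds_image gamma g d : 3 * gamma <= g ->
  shift_odds d @` semigroups_genus_even gamma g =
  semigroups_genus_even gamma (g + d).
Proof.
move=> gg; apply/seteqP; split=> [_ [S AS <-]|S].
  by apply: shift_odds_semigroup AS; lia.
rewrite -[S in semigroups_genus_even _ _ S]glueK.
move=> /semigroups_glueP[nT gT MT fM [gM _]].
pose M0 := [set m | odds S (d + m)].
have MM0 : odds S = addn d @` M0.
  apply/seteqP; split=> [m Mm|_ [m Mm <-]//].
  have [_ _ fT] := nT; have := relative_ideal_min fT MT Mm => cm.
  have dm : d <= m by lia.
  by exists (m - d); rewrite /M0 /= subnKC.
rewrite MM0 in MT fM gM.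
move/relative_ideal_translate: MT => MT; move/finite_translate: fM => fM.
rewrite card_translate // in gM.
exists (glue (evens S) M0).
  apply/semigroups_glueP; split=> //; split; first by lia.
  by move=> m m'; apply: relative_ideal_sum => //; lia.
by rewrite /shift_odds evens_glue odds_glue -MM0 glueK.
Qed.

Lemma num_semigroups_image gamma g d :
  card (shift_odds d @` semigroups_genus_even gamma g) = num_semigroups gamma g.
Proof.
by apply: card_image; [exact: shift_odds_inj|exact: finite_semigroups_genus_even].
Qed.

(** * A semigroup outside the image *)

(** The semigroup generated by 2 and 2 gamma + 1, whose largest gap
    2 gamma - 1 is as large as the genus gamma permits. *)
Definition hyperelliptic (gamma : nat) : set nat :=
  [set t | ~~ odd t || (2 * gamma <= t)].

Lemma gaps_hyperelliptic gamma :
  gaps (hyperelliptic gamma) = (fun i => i.*2.+1) @` `I_gamma.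
Proof.
apply/seteqP; split=> x; rewrite /gaps /hyperelliptic /=.
  by move=> /negP ?; exists x./2; lia.
by move=> [i ig <-]; apply/negP; lia.
Qed.

Lemma hyperelliptic_semigroup gamma :
  numerical_semigroup (hyperelliptic gamma) /\
  genus (hyperelliptic gamma) = gamma.
Proof.
have fI : finite_set `I_gamma by exact: finite_II.
split; last first.
  by rewrite /genus gaps_hyperelliptic card_image ?card_II //; exact: doubleS_inj.
split; [by [] | by move=> x y; rewrite /hyperelliptic /=; lia |].
by rewrite gaps_hyperelliptic; exact: finite_image.
Qed.

(** The pair (T, gamma + T) with T hyperelliptic has genus 3 gamma, and gamma is
    the least element of its second component. A preimage would have gamma - d
    in its odd part, so that T would contain the odd number
    2 (gamma - d) + 1 < 2 gamma. *)
Lemma shift_odds_not_onto gamma d : 0 < d -> d <= 3 * gamma ->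
  exists2 S, semigroups_genus_even gamma (3 * gamma) S &
  ~ (shift_odds d @` semigroups_genus_even gamma (3 * gamma - d)) S.
Proof.
move=> d0 dg; have [nT gT] := hyperelliptic_semigroup gamma.
have [T0 TD fT] := nT.
have MT : relative_ideal (hyperelliptic gamma)
    (addn gamma @` hyperelliptic gamma).
  by apply/relative_ideal_translate => m t; exact: TD.
have fM : finite_set (~` (addn gamma @` hyperelliptic gamma)).
  exact/finite_translate.
have cM : card (~` (addn gamma @` hyperelliptic gamma)) = 2 * gamma.
  by rewrite card_translate // [card _]gT; lia.
exists (glue (hyperelliptic gamma) (addn gamma @` hyperelliptic gamma)).
  apply/semigroups_glueP; split=> //; split; first by rewrite cM; lia.
  by move=> m m'; apply: relative_ideal_sum => //; rewrite cM gT.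
move=> [S]; rewrite -[S in semigroups_genus_even _ _ S]glueK.
move=> /semigroups_glueP[_ _ _ _ [_ MM]] eS.
have := congr1 evens eS; rewrite /shift_odds !evens_glue => eT.
have := congr1 odds eS; rewrite /shift_odds !odds_glue => eM.
(* The odd element of the preimage that d moves to gamma is m = gamma - d. *)
have : (addn gamma @` hyperelliptic gamma) gamma by exists 0; rewrite ?addn0.
rewrite -eM => -[m Mm em]; have := MM _ _ Mm Mm.
by rewrite eT /hyperelliptic /=; lia.
Qed.

Theorem corollary3p4 (g gamma : nat) (hg : 3 * gamma <= 2 * g) :
  num_semigroups gamma g <= num_semigroups gamma (3 * gamma) /\
  (num_semigroups gamma g = num_semigroups gamma (3 * gamma) <->
   3 * gamma <= g).
Proof.
have [gg|gg] := leqP (3 * gamma) g.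
  have -> : num_semigroups gamma g = num_semigroups gamma (3 * gamma).
    rewrite -(num_semigroups_image gamma (3 * gamma) (g - 3 * gamma)).
    by rewrite shift_odds_image // subnKC.
  by [].
pose d := 3 * gamma - g.
have gd : g + d = 3 * gamma by rewrite subnKC // ltnW.
have fB := finite_semigroups_genus_even gamma (3 * gamma).
have sub : shift_odds d @` semigroups_genus_even gamma g `<=`
    semigroups_genus_even gamma (3 * gamma).
  by move=> _ [S AS <-]; rewrite -gd; apply: shift_odds_semigroup; rewrite ?gd.
rewrite -(num_semigroups_image gamma g d); split; first exact: card_subset.
split=> // /(card_subset_eq fB sub) e.
have [|| S BS] := @shift_odds_not_onto gamma d; [lia|lia|].
have -> : 3 * gamma - d = g by lia.
by rewrite e => /(_ BS).
Qed.
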